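(* Let $k\ge 1$ be an integer with $k\equiv 2$ or $4\pmod 8$, and let $n\in\mathbb{Z}$ be divisible by $k+1$. Then $\gamma_{k+1,n}(q)$ vanishes for at least one value of $q\in\mathbb{C}$ with $0<|q|<1$.
   Context: For $q\in\mathbb{C}$ with $0<|q|<1$, an integer $k\ge1$ and $n\in\mathbb{Z}$, $$\gamma_{k,n}(q) := \sum_{\substack{m_1,\ldots,m_k\in\mathbb{Z}\\ m_1+\cdots+m_k=n}} q^{(m_1(m_1-1)+\cdots+m_k(m_k-1))/2};$$ equivalently, $\gamma_{k,n}(q)$ is the coefficient of $x^n$ in the Laurent expansion on $\mathbb{C}^*$ of $\theta_q(x)^k$, where $\theta_q(x):=\sum_{m\in\mathbb{Z}} q^{m(m-1)/2}x^m$. *)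

(* Defs.v *)
From HB Require Import structures.
From mathcomp Require Import all_boot all_order all_algebra.
From mathcomp Require Import complex.
From mathcomp Require Import all_classical all_reals all_analysis.
From mathcomp Require Import summability.

Set Implicit Arguments.
Unset Strict Implicit.
Unset Printing Implicit Defensive.

Import Order.TTheory GRing.Theory Num.Theory.
Import numFieldNormedType.Exports.

Local Open Scope ring_scope.
Local Open Scope complex_scope.

Definition tuple_sum_eq (k : nat) (n : int) : choiceType :=
  {m : {ffun 'I_k -> int} | \sum_(i < k) m i == n}.

(* Every m i * (m i - 1) is even and nonnegative, so the Euclidean quotient is
   exact and the integer power of q is an ordinary one.  The order-free sum
   (limit of the finite partial sums along inclusion) is meaningful for
   0 < `|q| < 1, where the family is absolutely summable. *)
Definition gamma (R : realType) (k : nat) (n : int) (q : R[i]) : R[i] :=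
  summability.sum (R := R[i]^o)
    (fun m : tuple_sum_eq k n =>
       q ^ ((\sum_(i < k) sval m i * (sval m i - 1)) %/ 2)%Z).

(* Main.v *)
Require Import Defs.
From mathcomp Require Import all_boot all_order all_algebra.
From mathcomp Require Import complex finmap.
From mathcomp Require Import all_classical all_reals all_analysis.
From mathcomp Require Import summability.
From mathcomp Require Import zify ring lra.

(** Write [N = k + 1] and [n = c N].  With [y = m - c], so that [y] runs over the
    integer vectors of sum 0, and [q = - s ^ 2], the value of gamma is a power of
    [q] times the real series
      [F s = \sum_y (-1) ^ (E y / 2) s ^ E y],  [E y = \sum_i y_i ^ 2].
    Since [F 0 = 1], it suffices to find [s < 1] with [F s < 0].  The sign is
    [i ^ E y], and [i ^ (y_i ^ 2) = (1 + i) / 2 + (1 - i) / 2 * (-1) ^ y_i];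
    expanding the product over [i] splits [F s] into the sums of
    [(-1) ^ (\sum_(i in J) y_i) s ^ E y] over the subsets [J] of the coordinates.
    For [J] empty or full this is the positive series [S = \sum_y s ^ E y], with
    total coefficient [2 Re (((1 - i) / 2) ^ N)], which is negative exactly when
    [N = 3] or [5] modulo 8.  For the other [J], moving a unit from a coordinate
    outside [J] to one inside flips the sign but hardly changes [s ^ E y], so
    that the sum is negligible with respect to [S] when [s] tends to 1. *)

Set Implicit Arguments.
Unset Strict Implicit.
Unset Printing Implicit Defensive.

Import Order.TTheory GRing.Theory Num.Theory.
Import numFieldNormedType.Exports.

Local Open Scope ring_scope.
Local Open Scope complex_scope.
Local Open Scope classical_set_scope.

#[local] Existing Instance totally_filter.

(** * Unordered sums of absolutely summable real families *)

Section Summation.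
Context {R : realType} {I : choiceType}.
Implicit Types (f g : I -> R) (A B : {fset I}).

Definition abs_summable f :=
  exists C : R, forall A, \sum_(i <- A) `|f i| <= C.

Definition tsum f : R := summability.sum (R := R^o) f.

Lemma partial_sumE (f : I -> R) A : partial_sum f A = \sum_(i <- A) f i.
Proof. by rewrite /partial_sum big_seq_fsetE. Qed.

Lemma sum_fset_le f A B : (A `<=` B)%fset -> (forall i, 0 <= f i) ->
  \sum_(i <- A) f i <= \sum_(i <- B) f i.
Proof.
move=> AB f0; rewrite (big_fsetID _ (mem A) B) /= -[leLHS]addr0 lerD ?sumr_ge0 //.
rewrite le_eqVlt; apply/orP; left; apply/eqP; apply: eq_fbigl => i.
by rewrite !inE /=; case: (boolP (i \in A)) => [/(fsubsetP AB) ->|]; rewrite ?andbF.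
Qed.

Lemma abs_summable_le f g : abs_summable g -> (forall i, `|f i| <= `|g i|) ->
  abs_summable f.
Proof. by move=> [C gC] fg; exists C => A; apply: le_trans (gC A); apply: ler_sum. Qed.

Lemma abs_summableD f g : abs_summable f -> abs_summable g ->
  abs_summable (fun i => f i + g i).
Proof.
move=> [C fC] [D gD]; exists (C + D) => A; apply: le_trans (lerD (fC A) (gD A)).
by rewrite -big_split /=; apply: ler_sum => i _; exact: ler_normD.
Qed.

Lemma abs_summableZ (a : R) f : abs_summable f -> abs_summable (fun i => a * f i).
Proof.
move=> [C fC]; exists (`|a| * C) => A; under eq_bigr do rewrite normrM.
by rewrite -mulr_sumr ler_wpM2l.
Qed.

Lemma abs_summable_abs f : abs_summable f -> abs_summable (fun i => `|f i|).
Proof. by move=> fs; apply: abs_summable_le fs _ => i; rewrite normr_id. Qed.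

Lemma tsum_unique f (l : R) : partial_sum f @ totally --> l -> tsum f = l.
Proof.
move=> fl; apply: (@cvg_lim R^o) fl => x y; exact: (@norm_hausdorff R R^o).
Qed.

(** Monotone convergence along inclusion: the limit is the supremum of the finite sums, and a finite
    set whose sum is within [e] of it serves for all larger sets. *)
Lemma tsum_cvg_ge0 f : abs_summable f -> (forall i, 0 <= f i) ->
  exists l : R, partial_sum f @ totally --> l.
Proof.
move=> [C fC] f0.
pose E := range (fun A => \sum_(i <- A) f i); exists (sup E).
have supE : has_sup E.
  split; first by exists (\sum_(i <- fset0) f i), fset0.
  by exists C => _ [A _ <-]; apply: le_trans (fC A); apply: ler_sum => i _; rewrite ler_norm.
apply/cvgrPdist_lt => e e0.
have [_ [A _ <-] Ae] := sup_adherent e0 supE.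
exists A => // B /= AB; rewrite partial_sumE.
have BE : \sum_(i <- B) f i <= sup E.
  by apply: ub_le_sup; [case: supE|exists B].
rewrite ger0_norm ?subr_ge0 // ltrBlDl -ltrBlDr.
exact: (lt_le_trans Ae (sum_fset_le AB f0)).
Qed.

(** Writing [f] as the difference of [|f| + f] and [|f|] reduces to two nonnegative families. *)
Lemma tsum_cvg f : abs_summable f -> partial_sum f @ totally --> tsum f.
Proof.
move=> fs; suff [l fl] : exists l : R, partial_sum f @ totally --> l.
  by rewrite (tsum_unique fl).
have fa := abs_summable_abs fs.
have [l1 h1] := tsum_cvg_ge0 fa (fun i => normr_ge0 _).
have [i|l2 h2] := tsum_cvg_ge0 (abs_summableD fa fs).
  by rewrite -lerBlDr sub0r -normrN ler_norm.
exists (l2 - l1).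
suff -> : partial_sum f = (fun A => partial_sum (fun i => `|f i| + f i) A -
   partial_sum (fun i => `|f i|) A) by exact: cvgB.
by apply/funext => A; rewrite !partial_sumE big_split /= addrAC subrr add0r.
Qed.

Lemma eq_tsum f g : f =1 g -> tsum f = tsum g.
Proof. by move=> /funext ->. Qed.

Lemma tsumD f g : abs_summable f -> abs_summable g ->
  tsum (fun i => f i + g i) = tsum f + tsum g.
Proof.
move=> fs gs; apply: tsum_unique.
suff -> : partial_sum (fun i => f i + g i) = partial_sum f \+ partial_sum g.
  by apply: cvgD; exact: tsum_cvg.
by apply/funext => A /=; rewrite !partial_sumE big_split.
Qed.

Lemma tsumZ (a : R) f : abs_summable f -> tsum (fun i => a * f i) = a * tsum f.
Proof.
move=> fs; apply: tsum_unique.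
suff -> : partial_sum (fun i => a * f i) = (fun A => a * partial_sum f A).
  by apply: cvgMr; exact: tsum_cvg.
by apply/funext => A /=; rewrite !partial_sumE mulr_sumr.
Qed.

Lemma tsumB f g : abs_summable f -> abs_summable g ->
  tsum (fun i => f i - g i) = tsum f - tsum g.
Proof.
move=> fs gs; rewrite -(mulN1r (tsum g)) -tsumZ // -tsumD //.
  by apply: eq_tsum => i; rewrite mulN1r.
exact: abs_summableZ.
Qed.

Lemma abs_summable_sum (J : Type) (s : seq J) (P : pred J) (F : J -> I -> R) :
  (forall j, P j -> abs_summable (F j)) ->
  abs_summable (fun i => \sum_(j <- s | P j) F j i).
Proof.
move=> Fs; elim: s => [|j s IH].
  by exists 0 => A; rewrite big1 // => i _; rewrite big_nil normr0.
case Pj: (P j); last by apply: abs_summable_le IH _ => i; rewrite big_cons Pj.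
by apply: abs_summable_le (abs_summableD (Fs _ Pj) IH) _ => i; rewrite big_cons Pj.
Qed.

Lemma tsum0 : tsum (fun=> 0) = 0.
Proof.
apply: tsum_unique; suff -> : partial_sum (fun _ : I => 0 : R) = cst 0 by exact: cvg_cst.
by apply/funext => A /=; rewrite partial_sumE big1.
Qed.

Lemma tsum_sum (J : Type) (s : seq J) (P : pred J) (F : J -> I -> R) :
  (forall j, P j -> abs_summable (F j)) ->
  tsum (fun i => \sum_(j <- s | P j) F j i) = \sum_(j <- s | P j) tsum (F j).
Proof.
move=> Fs; elim: s => [|j s IH].
  by rewrite big_nil -[RHS]tsum0; apply: eq_tsum => i; rewrite big_nil.
rewrite big_cons; case Pj: (P j); last first.
  by rewrite -IH; apply: eq_tsum => i; rewrite big_cons Pj.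
rewrite -IH -tsumD; [|exact: Fs|exact: abs_summable_sum].
by apply: eq_tsum => i; rewrite big_cons Pj.
Qed.

Lemma tsum_ge0 f : abs_summable f -> (forall i, 0 <= f i) -> 0 <= tsum f.
Proof.
move=> fs f0; apply: limr_ge; first by apply: cvgP; exact: tsum_cvg fs.
by exists fset0 => // A _ /=; rewrite partial_sumE sumr_ge0.
Qed.

Lemma le_tsum f g : abs_summable f -> abs_summable g ->
  (forall i, f i <= g i) -> tsum f <= tsum g.
Proof.
move=> fs gs fg; rewrite -subr_ge0 -tsumB //; apply: tsum_ge0.
  have := abs_summableD gs (abs_summableZ (-1) fs).
  by congr (abs_summable _); apply/funext => i; rewrite mulN1r.
by move=> i; rewrite subr_ge0.
Qed.

Lemma ler_norm_tsum f : abs_summable f -> `|tsum f| <= tsum (fun i => `|f i|).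
Proof.
move=> fs; have fa := abs_summable_abs fs.
rewrite ler_norml -mulN1r -tsumZ //; apply/andP; split; apply: le_tsum => //.
- exact: abs_summableZ.
- by move=> i; rewrite mulN1r lerNl -normrN ler_norm.
- by move=> i; rewrite ler_norm.
Qed.

Lemma tsum_fset A f : (forall i, i \notin A -> f i = 0) ->
  tsum f = \sum_(i <- A) f i.
Proof.
move=> f0; apply: tsum_unique; apply: cvg_near_cst.
exists A => // B /= AB; rewrite partial_sumE; apply/esym.
by apply: (big_fset_incl _ AB) => i _; exact: f0.
Qed.

End Summation.

(** * Invariance of sums under bijections of the index type *)

Section Reindex.
Context {R : realType} {I : choiceType} (h : I -> I) (h_bij : bijective h).
Implicit Types f : I -> R.

Lemma abs_summable_reindex f : abs_summable f -> abs_summable (f \o h).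
Proof.
move=> [C fC]; exists C => A; apply: le_trans (fC [fset h i | i in A]%fset).
by rewrite big_imfset //= => i j _ _; apply: bij_inj.
Qed.

Lemma tsum_reindex f : abs_summable f -> tsum (f \o h) = tsum f.
Proof.
move=> fs; apply: tsum_unique; have [g hK gK] := h_bij.
apply/cvgrPdist_lt => e e0.
have /cvgrPdist_lt/(_ e e0) [A _ HA] := tsum_cvg fs.
exists [fset g i | i in A]%fset => // B /= AB.
have := HA [fset h i | i in B]%fset.
rewrite /= !partial_sumE big_imfset /=; last by move=> i j _ _; apply: bij_inj.
apply; apply/fsubsetP => i iA; apply/imfsetP; exists (g i) => //=.
by apply: (fsubsetP AB); apply/imfsetP; exists i.
Qed.

End Reindex.

(** * Cancellation when the sign alternates along the orbits of a bijection *)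

Section Cancellation.
Context {R : realType} {I : choiceType}.
Variables (w sg : I -> R) (d : I -> int) (T : I -> I).
Hypotheses (T_bij : bijective T) (w_summable : abs_summable w).
Hypotheses (w_ge0 : forall i, 0 <= w i) (sg_le1 : forall i, `|sg i| <= 1).
Hypotheses (sgT : forall i, sg (T i) = - sg i) (dT : forall i, d (T i) = d i + 2).
Hypothesis w_decr : forall i, -1 <= d i -> w (T i) <= w i.
Hypothesis w_incr : forall i, d i < -1 -> w i <= w (T i).

(** The window for [d] has length 2, the step of [d] under [T], so exactly one point of each orbit
    of [T] is kept. *)
Let peak i := if (-1 <= d i < 1) then w i else 0.

Let restr_summable (v : I -> R) : (forall i, `|v i| <= w i) -> abs_summable v.
Proof.
by move=> vw; apply: abs_summable_le w_summable _ => i; rewrite (ger0_norm (w_ge0 _)).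
Qed.

Let peak_le i : `|peak i| <= w i.
Proof. by rewrite /peak; case: ifP => _; rewrite ?normr0 ?(ger0_norm (w_ge0 _)). Qed.

(* Reindexing by [T] gives [2 \sum sg w = \sum sg (w - w \o T)], and
   [\sum `|w - w \o T|] telescopes to twice the sum of [w] over the peak,
   which is where [w] stops increasing along the orbits of [T]. *)
Lemma alternating_tsum_le_peak : `|tsum (fun i => sg i * w i)| <= tsum peak.
Proof.
have sgw_le i : `|sg i * w i| <= w i.
  by rewrite normrM (ger0_norm (w_ge0 _)) ler_piMl.
have sgwT : abs_summable (fun i => sg i * w (T i)).
  apply: abs_summable_le (abs_summable_reindex T_bij w_summable) _ => i /=.
  by rewrite normrM ler_piMl.
have half : tsum (fun i => sg i * (w i - w (T i))) = 2 * tsum (fun i => sg i * w i).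
  under eq_tsum do rewrite mulrBr.
  rewrite tsumB //; last exact: restr_summable.
  have := tsum_reindex T_bij (restr_summable sgw_le).
  under eq_tsum do rewrite /= sgT mulNr -mulN1r.
  by rewrite tsumZ // => e; lra.
(* These give [|w i - w (T i)| = a i + b (T i)], while [a + b] is twice [peak]: reindexing [b] along
   [T] performs the telescoping. *)
pose a i := if -1 <= d i then w i else - w i.
pose b i := if 1 <= d i then - w i else w i.
have a_summable : abs_summable a.
  by apply: restr_summable => i; rewrite /a; case: ifP; rewrite ?normrN (ger0_norm (w_ge0 _)).
have b_summable : abs_summable b.
  by apply: restr_summable => i; rewrite /b; case: ifP; rewrite ?normrN (ger0_norm (w_ge0 _)).
have bT_summable := abs_summable_reindex T_bij b_summable.
have peak_summable := restr_summable peak_le.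
have abE : tsum (fun i => a i + b (T i)) = 2 * tsum peak.
  rewrite (tsumD a_summable bT_summable) (tsum_reindex T_bij b_summable).
  rewrite -tsumD // -tsumZ //; apply: eq_tsum => i; rewrite /a /b /peak.
  by case: (leP (-1) (d i)) => ?; case: (leP 1 (d i)) => ? /=; try lra; lia.
rewrite -(ler_pM2l (ltr0n _ 2)) -abE -[2 in leLHS]ger0_norm // -normrM -half.
have sgww : abs_summable (fun i => sg i * (w i - w (T i))).
  have := abs_summableD (restr_summable sgw_le) (abs_summableZ (-1) sgwT).
  by congr abs_summable; apply/funext => i; rewrite mulrBr mulN1r.
apply: (le_trans (ler_norm_tsum sgww)); apply: le_tsum.
- exact: abs_summable_abs.
- exact: abs_summableD.
move=> i; rewrite normrM; apply: (@le_trans _ _ `|w i - w (T i)|).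
  by rewrite ler_piMl.
rewrite /a /b dT; case: ifP => h.
  have -> : (1 <= d i + 2) by lia.
  by rewrite ger0_norm // subr_ge0 w_decr.
have -> : (1 <= d i + 2) = false by lia.
have d_lt : d i < -1 by lia.
by rewrite ler0_norm ?subr_le0 ?w_incr // opprB addrC.
Qed.

(* The translates of the peak by [T ^ a], [a < K], are disjoint. *)
Lemma alternating_tsum_small (K : nat) (c : R) : 0 <= c ->
  (forall i a, (a < K)%N -> -1 <= d i < 1 -> c * w i <= w (iter a T i)) ->
  K%:R * c * `|tsum (fun i => sg i * w i)| <= tsum w.
Proof.
move=> c_ge0 w_iter.
apply: le_trans (_ : K%:R * c * tsum peak <= _).
  by rewrite ler_wpM2l ?mulr_ge0 // alternating_tsum_le_peak.
pose piece (a : 'I_K) i := if (a%:Z *+ 2 - 1 <= d i < a%:Z *+ 2 + 1) then w i else 0.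
have piece_summable a : abs_summable (piece a).
  apply: restr_summable => i; rewrite /piece.
  by case: ifP => _; rewrite ?normr0 ?(ger0_norm (w_ge0 _)).
have iter_bij a : bijective (iter a T).
  by elim: a => [|a IH]; [exists id|exact: bij_comp].
have d_iter a i : d (iter a T i) = d i + a%:Z *+ 2.
  by elim: a => [|a IH]; rewrite ?addr0 // iterS dT IH; lia.
apply: (@le_trans _ _ (tsum (fun i => \sum_(a < K) piece a i))); last first.
  apply: le_tsum => // [|i]; first exact: abs_summable_sum.
  case: (pickP (fun a : 'I_K => a%:Z *+ 2 - 1 <= d i < a%:Z *+ 2 + 1)) => [a ha|no].
    rewrite (bigD1 a) //= big1 ?addr0; first by rewrite /piece ha.
    move=> b; rewrite /piece -val_eqE /=; case: ifP => // hb; move: ha hb; lia.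
  by rewrite big1 // => a _; rewrite /piece no.
rewrite tsum_sum // -mulrA -tsumZ; last exact: restr_summable.
rewrite mulr_natl -[in leLHS](card_ord K) -sumr_const; apply: ler_sum => a _.
rewrite -(tsum_reindex (iter_bij a) (piece_summable a)); apply: le_tsum => [||i].
- exact/abs_summableZ/restr_summable.
- exact: abs_summable_reindex.
rewrite /= /piece /peak d_iter.
have -> : (a%:Z *+ 2 - 1 <= d i + a%:Z *+ 2 < a%:Z *+ 2 + 1) = (-1 <= d i < 1) by lia.
by case: ifP => h; rewrite ?mulr0 // w_iter.
Qed.

End Cancellation.

(** * Continuity in [s] of signed sums of powers *)

Section PowerSums.
Context {R : realType} {I : choiceType}.
Variables (sg : I -> R) (e : I -> nat) (r : R).
Hypotheses (sg_le1 : forall i, `|sg i| <= 1) (r_ge0 : 0 <= r).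
Hypothesis r_summable : abs_summable (fun i => r ^+ e i).

Lemma signed_pow_le s : 0 <= s <= r -> forall i, `|sg i * s ^+ e i| <= r ^+ e i.
Proof.
move=> /andP[s0 sr] i; rewrite normrM -[leRHS]mul1r ler_pM //.
by rewrite ger0_norm ?exprn_ge0 // lerXn2r.
Qed.

Lemma signed_pow_summable s : 0 <= s <= r -> abs_summable (fun i => sg i * s ^+ e i).
Proof.
move=> sr; apply: abs_summable_le r_summable _ => i.
by apply: le_trans (signed_pow_le sr i) _; exact: ler_norm.
Qed.

(** The terms outside [A] are dominated by those at [r], so the bound on the remainder is uniform in
    [s], as in the Weierstrass test. *)
Lemma tsum_pow_truncation (A : {fset I}) s : 0 <= s <= r ->
  `|tsum (fun i => sg i * s ^+ e i) - \sum_(i <- A) sg i * s ^+ e i| <=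
  tsum (fun i => r ^+ e i) - \sum_(i <- A) r ^+ e i.
Proof.
move=> sr; pose cut (f : I -> R) i := if i \in A then f i else 0.
have cutE f : tsum (cut f) = \sum_(i <- A) f i.
  rewrite (@tsum_fset _ _ A) => [|i /negPf]; last by rewrite /cut => ->.
  by apply: eq_big_seq => i iA; rewrite /cut iA.
have cut_summable f : abs_summable f -> abs_summable (cut f).
  move=> fs; apply: abs_summable_le fs _ => i.
  by rewrite /cut; case: ifP => // _; rewrite normr0.
have sub_summable f : abs_summable f -> abs_summable (fun i => f i - cut f i).
  move=> fs; apply: abs_summable_le fs _ => i.
  by rewrite /cut; case: ifP => _; rewrite ?subrr ?subr0 ?normr0.
have ss := signed_pow_summable sr.
rewrite -!cutE -!tsumB //; [|exact: cut_summable..].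
apply: le_trans (ler_norm_tsum (sub_summable _ ss)) _.
apply: le_tsum; [exact/abs_summable_abs/sub_summable|exact: sub_summable|].
move=> i; rewrite /cut; case: ifP => _; first by rewrite !subrr normr0.
by rewrite !subr0 signed_pow_le.
Qed.

(** On [[0, r]] the sum is a uniform limit of finite sums, which are polynomials in [s]; the usual
    argument with three thirds of [eps] applies. *)
Lemma tsum_pow_continuous :
  {within `[0, r], continuous (fun s : R => tsum (fun i => sg i * s ^+ e i))}.
Proof.
(* Composing with the projection onto [[0, r]] extends the function to the whole line without
   changing it on the interval, so continuity can be proved at every real point. *)
pose clamp (s : R) := Num.max 0 (Num.min s r).
have clampP s : 0 <= clamp s <= r.
  by rewrite /clamp le_max lexx ge_max r_ge0 ge_min lexx orbT.
have clamp_cont : continuous clamp.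
  move=> s; apply: (@continuous_max R R (fun=> 0) (fun s => Num.min s r)).
    exact: cvg_cst.
  by apply: (@continuous_min R R id (fun=> r)); [exact: cvg_id|exact: cvg_cst].
suff : {within `[0, r], continuous (fun s => tsum (fun i => sg i * clamp s ^+ e i))}.
  apply: subspace_eq_continuous => s; rewrite inE /= in_itv /= => /andP[s0 sr].
  by rewrite /from_subspace /clamp (min_idPl sr) (max_idPr s0).
apply: continuous_subspaceT => x; apply/cvgrPdist_lt => eps eps0.
have eps3 : 0 < eps / 3 by lra.
have /cvgrPdist_lt/(_ _ eps3) [A _ /(_ A (fsubset_refl A))] := tsum_cvg r_summable.
rewrite /= partial_sumE => tail.
pose P (s : R) := \sum_(i <- A) sg i * clamp s ^+ e i.
have P_cont : {for x, continuous P}.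
  apply: (@cvg_big R) => [|i _]; first exact: add_continuous.
  apply: cvgMr.
  exact: (cvg_comp clamp (fun y => y ^+ e i) (clamp_cont x) (@exprn_continuous R (e i) (clamp x))).
have /cvgrPdist_lt/(_ _ eps3) := P_cont; apply: filterS => t Pt.
have near s := le_lt_trans (tsum_pow_truncation A (clampP s)) (le_lt_trans (ler_norm _) tail).
move: (near x) (near t) Pt; rewrite -/(P x) -/(P t) => hx ht Pt.
rewrite ltr_norml; move: hx ht Pt; rewrite !ltr_norml.
move=> /andP[? ?] /andP[? ?] /andP[? ?]; apply/andP; split; lra.
Qed.

End PowerSums.

(** * Summability of powers whose exponent is a sum of squares *)

Lemma geometric_sum_le (R : realFieldType) (s : R) (n : nat) : 0 <= s < 1 ->
  \sum_(j < n) s ^+ j <= (1 - s)^-1.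
Proof.
move=> /andP[s0 s1]; rewrite -[leRHS]mul1r ler_pdivlMr ?subr_gt0 // mulrC.
by rewrite -[X in X * _]opprB mulNr -subrX1 opprB lerBlDr lerDl exprn_ge0.
Qed.

(** Since [|y| <= |y| ^ 2], the terms are dominated by products of [N] powers with exponents
    [|y_j|]. Summing these gives a product of geometric series, with a factor 2 in each coordinate
    for the sign. *)
Lemma square_pow_summable (R : realType) (I : choiceType) (N : nat)
    (y : I -> 'I_N -> int) (s : R) : injective y -> 0 <= s < 1 ->
  abs_summable (fun i => s ^+ (\sum_(j < N) `|y i j| ^ 2)%N).
Proof.
move=> y_inj s01; have /andP[s0 s1] := s01.
exists (\prod_(j < N) (2 * (1 - s)^-1)) => A.
(* A bound on all coordinates over [A] lets [code] embed [A] in a finite type of functions,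
   recording sign and absolute value. *)
pose B := (\max_(i <- A) \max_(j < N) `|y i j|)%N.
have yB i j : i \in A -> (`|y i j| < B.+1)%N.
  move=> iA; rewrite ltnS; apply: leq_trans (leq_bigmax_seq _ iA isT).
  exact: leq_bigmax.
pose code i : {ffun 'I_N -> bool * 'I_B.+1} := [ffun j => (y i j < 0, inord `|y i j|)].
have code_inj : {in A &, injective code}.
  move=> i i' iA i'A /ffunP eq_code; apply: y_inj; apply/funext => j.
  have [] := congr1 id (eq_code j); rewrite !ffunE => -[eq_neg /(congr1 val)].
  by rewrite /= !inordK ?yB //; move: eq_neg; lia.
pose g (f : {ffun 'I_N -> bool * 'I_B.+1}) := \prod_j s ^+ (f j).2.
have g0 f : 0 <= g f by apply: prodr_ge0 => j _; exact: exprn_ge0.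
apply: (@le_trans _ _ (\sum_(i <- A) g (code i))).
  rewrite big_seq [leRHS]big_seq; apply: ler_sum => i iA.
  rewrite ger0_norm ?exprn_ge0 // /g -expr_sum; apply: ler_wiXn2l => //; first exact: ltW.
  by apply: leq_sum => j _; rewrite ffunE /= inordK ?yB //; nia.
apply: (@le_trans _ _ (\sum_f g f)).
  rewrite -(big_map code xpredT g) big_uniq /=; last by rewrite map_inj_in_uniq.
  rewrite [leRHS](bigID (mem [seq code i | i <- A])) /= lerDl.
  by apply: sumr_ge0.
rewrite -(bigA_distr_bigA (fun (j : 'I_N) (p : bool * 'I_B.+1) => s ^+ p.2)).
apply: ler_prod => j _; rewrite sumr_ge0 => [|p _]; last exact: exprn_ge0.
rewrite -(pair_bigA _ (fun (_ : bool) (i : 'I_B.+1) => s ^+ i)) /= big_bool /=.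
by rewrite mulr_natl mulr2n lerD // geometric_sum_le.
Qed.

(** * Centred coordinates and the exponent of [gamma] *)

Lemma int_parity (z : int) : exists a : int, z = 2 * a \/ z = 2 * a + 1.
Proof. by exists (z %/ 2)%Z; lia. Qed.

Lemma dvd2_sqrB (z : int) : (2 %| z ^+ 2 - z)%Z.
Proof.
have [a [->|->]] := int_parity z; apply/dvdzP.
  by exists (2 * a ^+ 2 - a); ring.
by exists (2 * a ^+ 2 + a); ring.
Qed.

Section Deviation.
Context {N : nat} {n : int} (c : int).
Implicit Types (m : tuple_sum_eq N n) (i p r : 'I_N).

Definition dev m i : int := sval m i - c.

Definition energy m : nat := (\sum_i `|dev m i| ^ 2)%N.

Lemma dev_inj : injective dev.
Proof.
move=> m m' /(congr1 (fun h => h _)) eq_dev; apply/val_inj/ffunP => i.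
by have := eq_dev i; rewrite /dev => /addIr.
Qed.

Lemma energyZ m : (energy m)%:Z = \sum_i dev m i ^+ 2.
Proof. by rewrite -natz natr_sum; apply: eq_bigr => i _; rewrite natz; lia. Qed.

Hypothesis n_eq : n = c * N%:Z.

Lemma sum_dev m : \sum_i dev m i = 0.
Proof.
rewrite sumrB (eqP (svalP m)) sumr_const card_ord n_eq.
by rewrite -mulr_natr natz subrr.
Qed.

(** Each square has the parity of its root, and the roots add up to 0. *)
Lemma dvd2_energy m : (2 %| energy m)%N.
Proof.
suff : (2 %| \sum_i dev m i ^+ 2)%Z by rewrite -energyZ dvdzE.
have -> : \sum_i dev m i ^+ 2 = \sum_i (dev m i ^+ 2 - dev m i).
  by rewrite sumrB sum_dev subr0.
apply: rpred_sum => i _; exact: dvd2_sqrB.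
Qed.

(** With [m = y + c], one has [m (m - 1) = y ^ 2 + (2 c - 1) y + c (c - 1)], and the linear term
    sums to 0. The last summand is independent of [m]: it is the exponent of the power of [q] to be
    factored out. *)
Lemma gamma_exponent m :
  ((\sum_i sval m i * (sval m i - 1)) %/ 2)%Z =
  (energy m)./2%:Z + ((N%:Z * (c * (c - 1))) %/ 2)%Z.
Proof.
have -> : \sum_i sval m i * (sval m i - 1) = (energy m)%:Z + N%:Z * (c * (c - 1)).
  transitivity (\sum_i (dev m i ^+ 2 + (2 * c - 1) * dev m i + c * (c - 1))).
    by apply: eq_bigr => i _; rewrite /dev; ring.
  rewrite !big_split /= -mulr_sumr sum_dev mulr0 addr0 -energyZ sumr_const card_ord.
  by rewrite -mulr_natl natz.
(* Both summands are even, so halving distributes over them exactly. *)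
have := dvd2_energy m; have := dvd2_sqrB c.
rewrite (_ : N%:Z * _ = N%:Z * (c ^+ 2 - c)); last by ring.
by move=> /dvdzP [a ->]; rewrite mulrA mulzK //; lia.
Qed.

End Deviation.

(** * Moving a unit from one coordinate to another *)

Section Transfer.
Context {N : nat} {n : int} (c : int) (p r : 'I_N) (pr : p != r).
Implicit Types m : tuple_sum_eq N n.

Lemma sum_delta (q : 'I_N) (F : 'I_N -> int) : \sum_i F i * (i == q)%:Z = F q.
Proof.
by rewrite (bigD1 q) //= eqxx mulr1 big1 ?addr0 // => i /negPf ->; rewrite mulr0.
Qed.

Lemma transfer_subproof (a b : 'I_N) m :
  \sum_(i < N) [ffun i => sval m i + (i == a)%:Z - (i == b)%:Z] i == n.
Proof.
under eq_bigr do rewrite ffunE -[X in _ + X - _]mul1r -[X in _ - X]mul1r.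
by rewrite sumrB big_split /= !(sum_delta _ (fun=> 1)) addrK (svalP m).
Qed.

Definition transfer (a b : 'I_N) m : tuple_sum_eq N n :=
  exist (fun x : {ffun 'I_N -> int} => \sum_(i < N) x i == n) _ (transfer_subproof a b m).

Lemma transferK (a b : 'I_N) : cancel (transfer a b) (transfer b a).
Proof. by move=> m; apply/val_inj/ffunP => i; rewrite !ffunE; ring. Qed.

Lemma transfer_bij (a b : 'I_N) : bijective (transfer a b).
Proof. exact: Bijective (transferK a b) (transferK b a). Qed.

Lemma dev_transfer m i :
  dev c (transfer p r m) i = dev c m i + (i == p)%:Z - (i == r)%:Z.
Proof. by rewrite /dev ffunE; ring. Qed.

(** This takes the role of [d] in the cancellation argument: a transfer changes the energy by
    [2 * gap + 2], so for [0 <= s < 1] the power [s ^+ energy] can grow only while the gap is below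
    -1. *)
Definition gap m := dev c m p - dev c m r.

Lemma gap_transfer m : gap (transfer p r m) = gap m + 2.
Proof.
by rewrite /gap !dev_transfer !eqxx [r == p]eq_sym (negPf pr) /=; ring.
Qed.

Lemma energy_transfer m :
  (energy c (transfer p r m))%:Z = (energy c m)%:Z + 2 * gap m + 2.
Proof.
rewrite !energyZ; transitivity (\sum_i (dev c m i ^+ 2
    + (2 * dev c m i + 1) * (i == p)%:Z - (2 * dev c m i - 1) * (i == r)%:Z)).
  apply: eq_bigr => i _; rewrite dev_transfer.
  case: (eqVneq i p) => [->|_]; first by rewrite (negPf pr) /=; ring.
  by case: eqP => _ /=; ring.
by rewrite sumrB big_split /= !sum_delta /gap; ring.
Qed.

Lemma gap_iter_transfer a m : gap (iter a (transfer p r) m) = gap m + 2 * a%:Z.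
Proof. by elim: a => [|a IH]; rewrite ?addr0 // iterS gap_transfer IH; lia. Qed.

(** The successive increments form an arithmetic progression. From a gap of -1 or 0, fewer than [K]
    transfers raise the energy by at most [2 * K ^ 2]. *)
Lemma energy_iter_transfer a m :
  (energy c (iter a (transfer p r) m))%:Z =
  (energy c m)%:Z + 2 * a%:Z * gap m + 2 * a%:Z ^+ 2.
Proof.
elim: a => [|a IH]; first by rewrite /=; ring.
by rewrite iterS energy_transfer gap_iter_transfer IH intS; ring.
Qed.

End Transfer.


(** * Expansion of the sign over the subsets of the coordinates *)

Section SignExpansion.
Context {R : realType} {N : nat} {n : int} (c : int).
Hypothesis n_eq : n = c * N%:Z.
Implicit Types (m : tuple_sum_eq N n) (f : {ffun 'I_N -> bool}).

(** Here [f] is the indicator function of the subset [J] of the overview. *)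
Definition parity_sign f m : R :=
  \prod_i (if f i then (-1) ^+ `|dev c m i|%N else 1).

Lemma normr_parity_sign f m : `|parity_sign f m| = 1.
Proof.
rewrite normr_prod big1 // => i _; case: ifP => _; last exact: normr1.
by rewrite normrX normrN1 expr1n.
Qed.

(** Only the factor at [p] changes, since the one at [r] is constantly 1. *)
Lemma parity_sign_transfer f p r m : f p -> ~~ f r ->
  parity_sign f (transfer p r m) = - parity_sign f m.
Proof.
move=> fp fr; have pr : p != r by apply: contraNneq fr => <-.
rewrite /parity_sign (bigD1 p) //= [in RHS](bigD1 p) //= fp -mulNr; congr (_ * _).
  rewrite dev_transfer eqxx (negPf pr) /= subr0 -signr_odd -[in RHS]signr_odd.
  have -> : odd `|(dev c m p + 1)%R|%N = ~~ odd `|dev c m p|%N by lia.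
  by case: odd; rewrite /= ?expr0 ?expr1 ?opprK.
apply: eq_bigr => i ip; case: ifP => // fi.
have ir : i != r by apply: contraNneq fr => <-.
by rewrite dev_transfer (negPf ip) (negPf ir) addr0 subr0.
Qed.

(** For the full subset the exponent [\sum_i |y_i|] has the parity of [\sum_i y_i = 0]. *)
Lemma parity_sign_const b m : parity_sign [ffun=> b] m = 1.
Proof.
rewrite /parity_sign; under eq_bigr do rewrite ffunE.
case: b; last by rewrite big1.
rewrite -expr_sum -signr_odd.
suff -> : odd (\sum_i `|dev c m i|)%N = false by [].
have : (2 %| \sum_i (`|dev c m i|%:Z - dev c m i))%Z.
  by apply: rpred_sum => i _; case: (dev c m i) => k; apply/dvdzP;
    [exists 0|exists k.+1%:Z]; lia.
rewrite sumrB sum_dev // subr0.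
have -> : \sum_i `|dev c m i|%:Z = (\sum_i `|dev c m i|)%N%:Z.
  by rewrite -natz natr_sum; apply: eq_bigr => i _; rewrite natz.
lia.
Qed.

(** The two values have sum 1 and difference [coef false - coef true = 'i], which match even and odd
    [y]. *)
Definition coef (b : bool) : R[i] :=
  if b then Complex 2^-1 (- 2^-1) else Complex 2^-1 2^-1.

(* [i ^ (y ^ 2)] is [1] for even [y] and [i] for odd [y]. *)
Lemma imaginary_square_pow (y : int) :
  'i ^+ (`|y| ^ 2) =
  \sum_b coef b * (if b then (-1) ^+ `|y|%N else 1)%:C :> R[i].
Proof.
have i4 : ('i : R[i]) ^+ 4 = 1 by rewrite (exprM _ 2 2) sqr_i sqrrN expr1n.
(* A square is 0 or 1 modulo 4, according to parity. *)
rewrite big_bool /= -signr_odd; have -> : (`|y| ^ 2 = 4 * (`|y| ^ 2 %/ 4) + odd `|y|)%N.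
  have : (`|y| = (`|y|./2).*2 + odd `|y|)%N by rewrite addnC odd_double_half.
  by move: (odd _) => [] {1 2}->; lia.
rewrite exprD exprM i4 expr1n mul1r; case: odd => /=.
all: by apply/eqP; rewrite eq_complex /= ?expr0 ?expr1; apply/andP; split; apply/eqP; simpc; lra.
Qed.

(** The energy is even, so the left side is the real number ['i ^+ energy]. Its product over the
    coordinates is distributed; as [parity_sign] is real, taking real parts affects only the
    coefficients. *)
Lemma energy_sign_expansion m :
  (-1) ^+ (energy c m)./2 =
  \sum_(f : {ffun 'I_N -> bool}) complex.Re (\prod_i coef (f i)) * parity_sign f m.
Proof.
have -> : (-1 : R) ^+ (energy c m)./2 = complex.Re ('i ^+ energy c m).
  have -> : energy c m = (2 * (energy c m)./2)%N by have := dvd2_energy n_eq m; lia.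
  by rewrite exprM sqr_i mul2n doubleK -(rmorphN1 (real_complex R)) -rmorphXn.
rewrite /energy expr_sum; under eq_bigr do rewrite imaginary_square_pow.
rewrite bigA_distr_bigA /=.
have ReD : {morph (@complex.Re R) : x y / x + y >-> x + y} by case=> ? ? [].
rewrite (big_morph _ ReD erefl); apply: eq_bigr => f _.
rewrite big_split /= -rmorph_prod; case: (\prod_i coef (f i)) => a b /=.
by rewrite mulr0 subr0.
Qed.

End SignExpansion.

(** * The real series as [s] tends to 1, and its zero *)

Lemma Bernoulli (R : realDomainType) (x : R) (n : nat) : 0 <= x <= 1 ->
  1 - n%:R * x <= (1 - x) ^+ n.
Proof.
move=> /andP[x0 x1]; elim: n => [|n IH]; first by rewrite mul0r subr0 expr0.
rewrite exprS; apply: (@le_trans _ _ ((1 - x) * (1 - n%:R * x))); last first.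
  by rewrite ler_wpM2l ?subr_ge0.
rewrite -subr_ge0 -natr1.
by rewrite [X in 0 <= X](_ : _ = n%:R * x ^+ 2); [rewrite mulr_ge0 ?exprn_ge0|ring].
Qed.

Section NearMinusOne.
Context {R : realType} {N : nat} {n : int} (c : int).
Hypothesis n_eq : n = c * N%:Z.
Notation T := (tuple_sum_eq N n).
Implicit Types (m : T) (f : {ffun 'I_N -> bool}).

Definition signed_theta (s : R) : R :=
  tsum (fun m : T => (-1) ^+ (energy c m)./2 * s ^+ energy c m).

Lemma energy_pow_summable (s : R) : 0 <= s < 1 ->
  abs_summable (fun m : T => s ^+ energy c m).
Proof. exact/square_pow_summable/dev_inj. Qed.

(** Only the constant vector [c] has energy 0, and [0 ^+ 0 = 1]. *)
Lemma signed_theta0 : signed_theta 0 = 1.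
Proof.
have m0P : \sum_(i < N) [ffun _ : 'I_N => c] i == n.
  under eq_bigr do rewrite ffunE.
  by rewrite sumr_const card_ord n_eq -mulr_natr natz.
pose m0 : T := exist (fun x : {ffun 'I_N -> int} => \sum_(i < N) x i == n) _ m0P.
have energy_m0 : energy c m0 = 0%N.
  by rewrite /energy big1 // => i _; rewrite /dev ffunE subrr.
rewrite /signed_theta (@tsum_fset _ _ [fset m0]%fset) => [|m].
  by rewrite big_seq_fset1 energy_m0 !expr0 mulr1.
rewrite inE => m_neq; rewrite expr0n; case: eqP => [energy0|]; last by rewrite mulr0.
case/eqP: m_neq; apply: (@dev_inj _ _ c); apply/funext => i.
rewrite /dev ffunE subrr; apply/eqP; rewrite -absz_eq0.
by move/eqP: energy0; rewrite sum_nat_eq0 => /forallP /(_ i); rewrite /= expn_eq0 andbT.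
Qed.

(** Cancellation along transfers from [r] outside the subset to [p] inside it. The factor
    [s ^+ (2 * K ^ 2)] bounds from below the loss over fewer than [K] transfers from the peak. *)
Lemma parity_tsum_small f (K : nat) (s : R) : 0 <= s < 1 ->
  (exists p, f p) -> (exists r, ~~ f r) ->
  K%:R * s ^+ (2 * K ^ 2) * `|tsum (fun m : T => parity_sign c f m * s ^+ energy c m)|
  <= tsum (fun m : T => s ^+ energy c m).
Proof.
move=> s01 [p fp] [r fr]; have pr : p != r by apply: contraNneq fr => <-.
have /andP[s0 s1] := s01.
apply: (alternating_tsum_small (T := transfer p r) (d := gap c p r)).
- exact: transfer_bij.
- exact: energy_pow_summable.
- by move=> m; exact: exprn_ge0.
- by move=> m; rewrite normr_parity_sign.
- by move=> m; exact: parity_sign_transfer.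
- exact: gap_transfer.
- move=> m gap_ge; apply: ler_wiXn2l => //; first exact: ltW.
  by have := energy_transfer c pr m; lia.
- move=> m gap_lt; apply: ler_wiXn2l => //; first exact: ltW.
  by have := energy_transfer c pr m; lia.
- exact: exprn_ge0.
move=> m a aK gap_small; rewrite -exprD; apply: ler_wiXn2l => //; first exact: ltW.
by have := energy_iter_transfer c pr a m; nia.
Qed.

Lemma signed_theta_expansion (s : R) : 0 <= s < 1 ->
  signed_theta s = \sum_(f : {ffun 'I_N -> bool}) complex.Re (\prod_i @coef R (f i)) *
    tsum (fun m : T => parity_sign c f m * s ^+ energy c m).
Proof.
move=> s01; have w_summable := energy_pow_summable s01; have /andP[s0 s1] := s01.
have f_summable f : abs_summable (fun m : T => parity_sign c f m * s ^+ energy c m).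
  by apply: abs_summable_le w_summable _ => m; rewrite normrM normr_parity_sign mul1r.
under eq_bigr do rewrite -tsumZ //.
rewrite -tsum_sum => [|f _]; last exact: abs_summableZ.
apply: eq_tsum => m; rewrite (energy_sign_expansion n_eq) mulr_suml.
by apply: eq_bigr => f _; rewrite mulrA.
Qed.

(** Each factor has modulus [1 / sqrt 2]. *)
Lemma coef_prod_le1 f : `|complex.Re (\prod_i @coef R (f i))| <= 1.
Proof.
rewrite -lecR; apply: le_trans (normc_ge_Re _) _; rewrite normr_prod.
apply: prodr_ile1 => i _; rewrite normr_ge0 normc_def lecR.
have -> : (complex.Re (@coef R (f i))) ^+ 2 + (complex.Im (@coef R (f i))) ^+ 2 = 2^-1.
  by case: (f i); rewrite /= ?sqrrN; field.
by rewrite -[leRHS]sqrtr1 ler_wsqrtr //; lra.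
Qed.

(** The fourth power of [(1 + i) / 2] and of its conjugate is [- 1 / 4], so the sign has period 8 in
    [N]. The cube has real part [- 1 / 4]; exponent 5 gives [- 1 / 4] times [1 / 2]. *)
Lemma coef_const_neg : (N = 3 %[mod 8])%N \/ (N = 5 %[mod 8])%N ->
  forall b, complex.Re (\prod_(i < N) @coef R ([ffun=> b] i)) < 0.
Proof.
move=> N_mod b; under eq_bigr do rewrite ffunE.
rewrite prodr_const card_ord.
have coef4 : @coef R b ^+ 4 = (- 4^-1)%:C.
  by apply/eqP; rewrite eq_complex; case: b => /=; apply/andP; split; apply/eqP; field.
have coefE (q j : nat) : complex.Re (@coef R b ^+ (4 * q + j)) =
    (- 4^-1) ^+ q * complex.Re (@coef R b ^+ j).
  rewrite exprD exprM coef4 -rmorphXn; case: (@coef R b ^+ j) => x y /=.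
  by rewrite mul0r subr0.
have pow_gt0 (q : nat) : 0 < (- 4^-1 : R) ^+ (2 * q).
  by rewrite exprM sqrrN; apply: exprn_gt0; lra.
case: N_mod => N_mod.
  have -> : N = (4 * (2 * (N %/ 8)) + 3)%N by lia.
  rewrite coefE pmulr_rlt0 //.
  suff -> : complex.Re (@coef R b ^+ 3) = - 4^-1 by lra.
  by case: b {coef4 coefE}; rewrite /=; field.
have -> : N = (4 * (2 * (N %/ 8)).+1 + 1)%N by lia.
rewrite coefE exprSr expr1 -mulrA pmulr_rlt0 //.
by case: b {coef4 coefE} => /=; lra.
Qed.

(** The two constant [f] contribute [- delta * S], and each of the at most [M] others at most
    [2 * S / K]; taking [K > 2 * M / delta] makes the total negative. *)
Lemma signed_theta_neg : (N = 3 %[mod 8])%N \/ (N = 5 %[mod 8])%N ->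
  exists2 s : R, 0 <= s < 1 & signed_theta s < 0.
Proof.
move=> N_mod; have N_gt0 : (0 < N)%N by case: N_mod => N_mod; lia.
pose b f := complex.Re (\prod_i @coef R (f i)).
pose delta := - (b [ffun=> true] + b [ffun=> false]).
have delta_gt0 : 0 < delta.
  by have := coef_const_neg N_mod true; have := coef_const_neg N_mod false; rewrite /delta /b; lra.
pose M : R := #|{ffun 'I_N -> bool}|%:R.
have M_ge0 : 0 <= M by [].
have := archi_boundP (divr_ge0 (mulr_ge0 (ler0n R 2) M_ge0) (ltW delta_gt0)).
set K := Num.bound _ => K_large.
have K_gt0 : 0 < K%:R :> R.
  by apply: le_lt_trans K_large; rewrite divr_ge0 ?mulr_ge0 // ltW.
have K_nat_gt0 : (0 < K)%N by move: K_gt0; rewrite ltr0n.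
(* Chosen so that [2 * K ^ 2 * x = 1 / 2]: Bernoulli's inequality then keeps
   [(1 - x) ^+ (2 * K ^ 2)] above one half. *)
pose x : R := (4 * K%:R ^+ 2)^-1.
have x_gt0 : 0 < x by rewrite invr_gt0 mulr_gt0 ?exprn_gt0.
have x_lt1 : x < 1.
  rewrite invf_lt1 ?mulr_gt0 ?exprn_gt0 //.
  have : 1 <= K%:R ^+ 2 :> R by rewrite exprn_ege1 // ler1n.
  by lra.
have s01 : 0 <= 1 - x < 1 by apply/andP; split; lra.
exists (1 - x) => //.
have pow_half : 2^-1 <= (1 - x) ^+ (2 * K ^ 2).
  apply: le_trans (Bernoulli _ _); last by apply/andP; split; lra.
  rewrite natrM natrX /x; have : K%:R != 0 :> R by rewrite lt0r_neq0.
  by move=> K0; rewrite [leRHS](_ : _ = 2^-1) //; field.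
pose G f := tsum (fun m : T => parity_sign c f m * (1 - x) ^+ energy c m).
pose S := tsum (fun m : T => (1 - x) ^+ energy c m).
have G_const e : G [ffun=> e] = S.
  by apply: eq_tsum => m; rewrite (parity_sign_const n_eq) mul1r.
(* In fact [1 <= S], by comparing termwise with the series at 0, whose value is 1. *)
have S_gt0 : 0 < S.
  apply: lt_le_trans ltr01 _; rewrite -signed_theta0; apply: le_tsum => [||m].
  - apply: (@signed_pow_summable _ _ _ _ (1 - x)).
    + by move=> m; rewrite normrX normrN1 expr1n.
    + by case/andP: s01.
    + exact: energy_pow_summable.
    + by rewrite lexx; case/andP: s01.
  - exact: energy_pow_summable.
  case: (energy c m) => [|E]; first by rewrite /= !expr0 mulr1.
  by rewrite [X in _ * X]expr0n mulr0 exprn_ge0 //; case/andP: s01.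
have G_small f : (f != [ffun=> true]) && (f != [ffun=> false]) -> `|G f| <= 2 * S / K%:R.
  move=> /andP[f_true f_false]; rewrite ler_pdivlMr //.
  have := @parity_tsum_small f K _ s01; rewrite -/(G f) -/S => bound.
  have {bound} : K%:R * (1 - x) ^+ (2 * K ^ 2) * `|G f| <= S.
    apply: bound.
      apply/existsP; apply: contraNT f_false; rewrite negb_exists => /forallP no.
      by apply/eqP/ffunP => i; rewrite ffunE; apply/negbTE/no.
    apply/existsP; apply: contraNT f_true; rewrite negb_exists => /forallP no.
    by apply/eqP/ffunP => i; rewrite ffunE; apply/negPn/no.
  have : K%:R * 2^-1 * `|G f| <= K%:R * (1 - x) ^+ (2 * K ^ 2) * `|G f|.
    by rewrite ler_wpM2r // ler_wpM2l // ltW.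
  move=> /le_trans /[apply].
  rewrite (_ : `|G f| * K%:R = 2 * (K%:R * 2^-1 * `|G f|)); last by field.
  by rewrite ler_pM2l.
have const_neq : ([ffun=> false] : {ffun 'I_N -> bool}) != [ffun=> true].
  by apply/eqP => /ffunP /(_ (Ordinal N_gt0)); rewrite !ffunE.
rewrite signed_theta_expansion // -/(G _) (bigD1 [ffun=> true]) //= (bigD1 [ffun=> false]) //=.
rewrite -/(b _) -/(b _) -!/(G _) !G_const addrA -mulrDl.
apply: (@le_lt_trans _ _ (- delta * S + M * (2 * S / K%:R))).
  rewrite /delta opprK lerD2l.
  apply: (@le_trans _ _ (\sum_(f : {ffun 'I_N -> bool} |
      (f != [ffun=> true]) && (f != [ffun=> false])) 2 * S / K%:R)).
    apply: ler_sum => f f_nc; apply: le_trans (ler_norm _) _.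
    by rewrite normrM -[leRHS]mul1r ler_pM // ?coef_prod_le1 // G_small.
  rewrite sumr_const -[leLHS]mulr_natl ler_wpM2r ?ler_nat ?max_card //.
  by rewrite divr_ge0 ?mulr_ge0 ?ltW.
have -> : - delta * S + M * (2 * S / K%:R) = S * (2 * M / K%:R - delta).
  by move: (K%:R^-1 : R) => k; ring.
rewrite pmulr_rlt0 // subr_lt0 ltr_pdivrMr // [ltRHS]mulrC.
by rewrite -ltr_pdivrMr.
Qed.

(** Intermediate values between 1 at 0 and a negative value at [r]; the zero is not 0 itself, which
    will make [q] nonzero. *)
Lemma signed_theta_zero : (N = 3 %[mod 8])%N \/ (N = 5 %[mod 8])%N ->
  exists2 s : R, 0 < s < 1 & signed_theta s = 0.
Proof.
move=> N_mod; have [r r01 r_neg] := signed_theta_neg N_mod.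
have /andP[r0 r1] := r01.
have cont : {within `[0, r], continuous signed_theta}.
  apply: tsum_pow_continuous => //; last exact: energy_pow_summable.
  by move=> m; rewrite normrX normrN1 expr1n.
have [|s] := IVT (v := 0) r0 cont.
  by rewrite signed_theta0 ge_min le_max ler01 (ltW r_neg) orbT.
rewrite in_itv /= => /andP[s0 sr] s_zero; exists s => //.
rewrite (le_lt_trans sr r1) andbT lt_neqAle s0 andbT.
by apply: contraPneq s_zero => <-; rewrite signed_theta0; exact/eqP/oner_neq0.
Qed.

End NearMinusOne.

(** * Return to the complex series [gamma] *)

Lemma complex_sum (R : realType) (I : choiceType) (f : I -> R) (z : R[i]) :
  abs_summable f ->
  summability.sum (R := R[i]^o) (fun i => z * (f i)%:C) = z * (tsum f)%:C.
Proof.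
move=> fs; apply: (@cvg_lim R[i]^o) => [x y|]; first exact: (@norm_hausdorff R[i] R[i]^o).
have -> : partial_sum (fun i => z * (f i)%:C : R[i]^o) =
    (fun A => z * (partial_sum f A)%:C).
  by apply/funext => A; rewrite /partial_sum -mulr_sumr rmorph_sum.
apply: (@cvgMr R[i]); apply/(@cvgrPdist_lt R[i] R[i]^o) => e e0.
(* The norm of [R[i]] takes values in [R[i]], so the tolerance [e] is a complex number; being
   positive, it is real. *)
have eE : e = (complex.Re e)%:C by rewrite RRe_real // gtr0_real.
move: e0; rewrite eE ltcR => e0.
have /cvgrPdist_lt/(_ _ e0) := tsum_cvg fs; apply: filterS => A.
by rewrite -rmorphB normc_def /= expr0n addr0 sqrtr_sqr ltcR.
Qed.

Lemma gamma_negative_real (R : realType) (N : nat) (n c : int) (s : R) :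
  n = c * N%:Z -> 0 < s < 1 ->
  gamma N n (- s ^+ 2)%:C =
  (- s ^+ 2)%:C ^ ((N%:Z * (c * (c - 1))) %/ 2)%Z * (signed_theta (N := N) (n := n) c s)%:C.
Proof.
move=> n_eq /andP[s0 s1].
(* Splitting a power with integer exponents, by [expfzDr], requires a nonzero base. *)
have q_neq0 : (- s ^+ 2)%:C != 0 :> R[i].
  by rewrite (fmorph_eq0 (real_complex R)) oppr_eq0 expf_neq0 // gt_eqF.
rewrite -complex_sum; last first.
  apply: (@signed_pow_summable _ _ _ _ s) => [m|||].
  - by rewrite normrX normrN1 expr1n.
  - exact: ltW.
  - by apply: energy_pow_summable; rewrite ltW /=.
  - by rewrite lexx ltW.
rewrite /gamma; apply: (congr1 (summability.sum (R := R[i]^o))); apply/funext => m.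
rewrite (gamma_exponent n_eq) expfzDr // mulrC -exprnP -rmorphXn; congr (_ * _%:C).
(* [(- s ^ 2) ^ (E / 2) = (-1) ^ (E / 2) * s ^ E], because the energy [E] is even. *)
rewrite [LHS]exprNn -exprM; congr (_ * _ ^+ _).
by have := dvd2_energy n_eq m; lia.
Qed.

Theorem proposition7 (R : realType) (k : nat) (n : int)
    (k_ge1 : (1 <= k)%N)
    (k_mod8 : (k = 2 %[mod 8])%N \/ (k = 4 %[mod 8])%N)
    (dvd_n : (k.+1%:Z %| n)%Z) :
  exists q : R[i], 0 < `|q| < 1 /\ gamma k.+1 n q = 0.
Proof.
have n_eq : n = (n %/ k.+1%:Z)%Z * k.+1%:Z by rewrite divzK.
have N_mod : (k.+1 = 3 %[mod 8])%N \/ (k.+1 = 5 %[mod 8])%N.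
  by case: k_mod8 => k_mod; [left|right]; lia.
have [s s01 s_zero] := signed_theta_zero (R := R) n_eq N_mod.
have /andP[s0 s1] := s01.
exists (- s ^+ 2)%:C; split; last first.
  by rewrite (gamma_negative_real n_eq s01) s_zero mulr0.
rewrite normc_def /= expr0n addr0 sqrtr_sqr normrN normrX (gtr0_norm s0) !ltcR.
by rewrite exprn_gt0 // exprn_ilt1 // ltW.
Qed.
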